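(* Let $H$ be a finite dimensional complex Hilbert space and let $\alpha:\mathcal{B}(H)\to\mathcal{B}(H)$ be a non-zero completely positive map which is nilpotent of order $p$, and let $\alpha^*$ be its conjugate map (which is also nilpotent of order $p$). Let $(a_1,a_2,\dots,a_p)$ be the CP nilpotent type of $\alpha$ and $(a^1,a^2,\dots,a^p)$ the CP nilpotent type of $\alpha^*$ (superscripts are indices, not powers). Then $$a_{p-i+1}+a_{p-i+2}+\cdots+a_p\le a^1+a^2+\cdots+a^i\quad\text{for all }1\le i\le p,$$ and $a_1+a_2+\cdots+a_p=a^1+a^2+\cdots+a^p$.
   Context: $\mathcal{B}(H)$ is the algebra of all linear maps on $H$ and $1$ denotes its identity. Every completely positive map $\alpha$ on $\mathcal{B}(H)$ has a Choi-Kraus decomposition $\alpha(X)=\sum_{i=1}^d L_i^*XL_i$ with $L_i\in\mathcal{B}(H)$. Its conjugate map is the completely positive map $\alpha^*(X)=\sum_{i=1}^d L_iXL_i^*$; it is independent of the choice of decomposition, and is characterized by $\operatorname{trace}[\alpha(X)^*Y]=\operatorname{trace}[X^*\alpha^*(Y)]$ for all $X,Y\in\mathcal{B}(H)$. A linear map $A$ is nilpotent of order $p$ if $A^p=0$ and $p$ is the smallest such number. For a completely positive map $\theta$ on $\mathcal{B}(H)$ nilpotent of order $p$, the CP nilpotent type of $\theta$ is the tuple $(\dim K_1,\dots,\dim K_p)$, where $K_1=\ker(\theta(1))$ and $K_k=\ker(\theta^k(1))\cap(\ker(\theta^{k-1}(1)))^\perp$ for $2\le k\le p$; one has $H=K_1\oplus\cdots\oplus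 K_p$. *)

(* Defs.v *)
From mathcomp Require Import all_boot all_order all_algebra.
From mathcomp Require Import sesquilinear complex.
From mathcomp Require Import boolp classical_sets reals.

Set Implicit Arguments.
Unset Strict Implicit.
Unset Printing Implicit Defensive.

Import Order.TTheory GRing.Theory Num.Theory Num.Def.
Local Open Scope ring_scope.

(* A finite dimensional complex Hilbert space is a finite dimensional vector  *)
(* space H over R[i], R : realType, together with a positive definite         *)
(* hermitian form dot; following the library, dot is linear in its first      *)
(* argument and conjugate linear in the second one. B(H) is 'End(H).          *)

Section CPNilpotent.
Variables (R : realType) (H : vectType R[i]) (dot : {dot H for conjC}).

Definition is_adjoint (A B : 'End(H)) : Prop :=
  forall u v : H, dot (A u) v = dot u (B v).

(* Every A has exactly one adjoint, so the default value 0 is never used. *)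
Definition adjoint (A : 'End(H)) : 'End(H) :=
  xget 0 [set B | is_adjoint A B]%classic.

(* The block operator [X i j] in M_m(B(H)) = B(H^m) is positive:              *)
(* <[X i j] u, u> >= 0 for every u = (u_0, ..., u_(m-1)) in H^m. The order of *)
(* R[i] makes this include that the sum is real.                              *)
Definition block_positive (m : nat) (X : 'I_m -> 'I_m -> 'End(H)) : Prop :=
  forall u : 'I_m -> H, 0 <= \sum_i \sum_j dot (X i j (u j)) (u i).

(* Used on linear maps only: linearity is part of the type of the map in the  *)
(* theorem.                                                                   *)
Definition completely_positive (theta : 'End(H) -> 'End(H)) : Prop :=
  forall (m : nat) (X : 'I_m -> 'I_m -> 'End(H)),
    block_positive X -> block_positive (fun i j => theta (X i j)).

Definition choi_kraus (theta : 'End(H) -> 'End(H)) (Ls : seq 'End(H)) : Prop :=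
  forall X : 'End(H), theta X = \sum_(L <- Ls) (adjoint L \o X \o L)%VF.

(* A Choi-Kraus decomposition is picked by choice: one exists for every       *)
(* completely positive linear map, and the conjugate map does not depend on   *)
(* it. The value is meaningless for maps without a decomposition.             *)
Definition conjugate_map (theta : 'End(H) -> 'End(H)) (X : 'End(H)) : 'End(H) :=
  \sum_(L <- xget [::] [set Ls | choi_kraus theta Ls]%classic)
     (L \o X \o adjoint L)%VF.

Definition nilpotent_of_order (theta : 'End(H) -> 'End(H)) (p : nat) : Prop :=
  (forall X, iter p theta X = 0) /\
  (forall q, (forall X, iter q theta X = 0) -> (p <= q)%N).

(* nil_space theta k is the subspace K_(k+1). *)
Definition nil_space (theta : 'End(H) -> 'End(H)) (k : nat) : {vspace H} :=
  if k is k'.+1 then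
    (lker (iter k'.+2 theta \1%VF)
       :&: orthov dot (lker (iter k'.+1 theta \1%VF)))%VS
  else lker (theta \1%VF).

Definition cp_nilpotent_type (theta : 'End(H) -> 'End(H)) (p : nat) :
    p.-tuple nat :=
  [tuple \dim (nil_space theta k) | k < p].

End CPNilpotent.

(* Main.v *)
Require Import Defs.
From HB Require Import structures.
From mathcomp Require Import all_boot all_order all_algebra.
From mathcomp Require Import sesquilinear spectral complex.
From mathcomp Require Import boolp classical_sets reals.
From mathcomp Require Import ring.

Import Order.TTheory GRing.Theory Num.Theory Num.Def.
Local Open Scope ring_scope.

(* Fix a Choi-Kraus decomposition of alpha with operators L_1, ..., L_d (it   *)
(* exists because the Choi matrix is positive semidefinite, hence a Gram      *)
(* matrix). Then ker (alpha^k(1)) is the common kernel M_k of the words of    *)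
(* length k in the L_i, and a_1 + ... + a_k = dim M_k; likewise for the       *)
(* conjugate map, whose words are the adjoints of those of alpha, with common *)
(* kernels N_k. Words of length p vanish, so a word of length i has its range *)
(* in M_(p-i), whence its adjoint kills the orthogonal complement of M_(p-i): *)
(* this complement is contained in N_i, and comparing dimensions gives the    *)
(* inequality.                                                                *)

(** Nilpotency and kernels are both read off words. By [choi_kraus_iter] the words of length k
    decompose the k-th iterate, and [ker_choi_krausP] turns its kernel at the identity into a common
    kernel, since a sum of squared norms vanishes only termwise. [sum_dim_nil_space] telescopes the
    type into dimensions of such kernels. Adjoints merely reverse words ([words_adjoint]), so both
    maps have the same order of nilpotency, and both types sum to the dimension of [H]. *)

Section PositiveSemidefinite.
Set Implicit Arguments.
Unset Strict Implicit.
Variable C : numClosedFieldType.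
Local Open Scope sesquilinear_scope.

(* Polarization: reality of the form at e_i + e_j and at e_i + 'i e_j. *)
Lemma psdmx_hermitian n (A : 'M[C]_n) :
  (forall u : 'rV_n, 0 <= (u *m A *m u^t*) 0 0) -> A^t* = A.
Proof.
pose q (u v : 'rV[C]_n) := (u *m A *m v^t*) 0 0.
move=> A_ge0.
have realA u : conjC (q u u) = q u u by exact/CrealP/ger0_real/A_ge0.
have entry i j : q (delta_mx 0 i) (delta_mx 0 j) = A i j.
  by rewrite /q -rowE trmx_delta map_delta_mx -colE !mxE.
have expand (c : C) i j (u := delta_mx 0 i + c *: delta_mx 0 j) :
    q u u = A i i + c^* * A i j + c * A j i + c * c^* * A j j.
  rewrite /q /u linearD /= linearZ /= map_mxD map_mxZ !mulmxDl !mulmxDr.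
  rewrite -!scalemxAl -!scalemxAr.
  do !rewrite [(_ + _ : 'M_(_, _)) 0 0]mxE.
  do !rewrite [(_ *: _ : 'M_(_, _)) 0 0]mxE.
  rewrite -!/(q _ _) !entry; ring.
have diagA i : (A i i)^* = A i i by rewrite -[A i i]entry realA.
apply/matrixP => i j; rewrite !mxE.
have E1 := realA (delta_mx 0 i + 1 *: delta_mx 0 j).
have Ei := realA (delta_mx 0 i + 'i *: delta_mx 0 j).
move: E1 Ei; rewrite !expand !rmorphD !rmorphM /= !conjCK !conjCi !diagA conjC1.
move=> E1 Ei.
have {}E1 : (A i j)^* + (A j i)^* = A i j + A j i.
  by apply/(addrI (A i i))/(addIr (A j j)); move: E1; rewrite !mul1r !addrA.
have {}Ei : (A i j)^* - (A j i)^* = A j i - A i j.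
  apply/(mulfI (neq0Ci C))/(addrI (A i i))/(addIr ('i * - 'i * A j j)).
  by move: Ei; rewrite !mulrBr !(mulNr, mulrN) !addrA (addrAC (A i i) (- _)).
have two : 2%:R != 0 :> C by rewrite pnatr_eq0.
(* Subtracting [Ei] from [E1] leaves twice the hermitian relation. *)
apply: (mulfI two).
rewrite (_ : _ * (A j i)^* = (A i j)^* + (A j i)^* - ((A i j)^* - (A j i)^*)).
  by rewrite E1 Ei; ring.
by ring.
Qed.

(** Spectral theorem: the eigenvalues are values of the form at the rows of the unitary [P], hence
    nonnegative, and [B] absorbs their square roots. *)
Lemma psdmx_factor n (A : 'M[C]_n) :
  (forall u : 'rV_n, 0 <= (u *m A *m u^t*) 0 0) -> exists B : 'M_n, A = B *m B^t*.
Proof.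
move=> A_ge0; set P := spectralmx A; set d := spectral_diag A.
have PU : P \is unitarymx by apply: spectral_unitarymx.
have /orthomx_spectralP : A \is normalmx.
  by apply/normalmxP; rewrite psdmx_hermitian.
rewrite -/P -/d invmx_unitary // => AE.
have d_ge0 k : 0 <= d 0 k.
  suff <- : (row k P *m A *m (row k P)^t*) 0 0 = d 0 k by apply: A_ge0.
  rewrite rowE trmx_mul map_mxM [in LHS]AE !mulmxA !mulmxtVK // -rowE.
  by rewrite trmx_delta map_delta_mx -colE !mxE eqxx.
pose s := diag_mx (\row_k sqrtC (d 0 k)).
exists (P^t* *m s); rewrite trmx_mul map_mxM trmxCK mulmxA -(mulmxA _ s).
rewrite {1}AE; congr (_ *m _ *m _).
rewrite tr_diag_mx map_diag_mx mulmx_diag; congr diag_mx.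
apply/rowP => k; rewrite !mxE.
by rewrite /= (CrealP (ger0_real _)) ?sqrtC_ge0 // -expr2 sqrtCK.
Qed.

(** Transfers the factorization to any finite index type; the Choi matrix is indexed by pairs. *)
Lemma psd_factor (T : finType) (A : T -> T -> C) :
  (forall c : T -> C, 0 <= \sum_s \sum_t c s * A s t * (c t)^*) ->
  exists B : T -> 'I_#|T| -> C, forall s t, A s t = \sum_k B s k * (B t k)^*.
Proof.
move=> A_ge0; pose M : 'M_#|T| := \matrix_(i, j) A (enum_val i) (enum_val j).
have [u|B MB] := @psdmx_factor _ M.
  have := A_ge0 (fun s => u 0 (enum_rank s)); congr (0 <= _).
  rewrite exchange_big mxE (reindex _ (onW_bij _ (enum_val_bij T))) /=.
  apply: eq_bigr => j _; rewrite !mxE mulr_suml.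
  rewrite (reindex _ (onW_bij _ (enum_val_bij T))) /=.
  by apply: eq_bigr => i _; rewrite !mxE !enum_valK.
exists (fun s k => B (enum_rank s) k) => s t.
have := congr1 (fun X : 'M_#|T| => X (enum_rank s) (enum_rank t)) MB.
rewrite !mxE !enum_rankK => ->.
by apply: eq_bigr => k _; rewrite !mxE.
Qed.

End PositiveSemidefinite.

(** * Orthonormal bases *)

Section OrthonormalBasis.
Set Implicit Arguments.
Unset Strict Implicit.
Variables (C : numClosedFieldType) (H : vectType C) (dot : {dot H for conjC}).
Local Open Scope sesquilinear_scope.

Lemma dotC (u v : H) : dot u v = (dot v u)^*.
Proof. by rewrite hermC expr0 mul1r. Qed.

Lemma dot_sumlZ (T : finType) (c : T -> C) (x : T -> H) v :
  dot (\sum_i c i *: x i) v = \sum_i c i * dot (x i) v.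
Proof. by rewrite linear_sumlz; apply: eq_bigr => i _; rewrite linearZl_LR. Qed.

Lemma dot_sumrZ (T : finType) (c : T -> C) (x : T -> H) v :
  dot v (\sum_i c i *: x i) = \sum_i (c i)^* * dot v (x i).
Proof. by rewrite linear_sumr; apply: eq_bigr => i _; rewrite linearZr_LR. Qed.

Lemma dot_inj (u v : H) : (forall w, dot u w = dot v w) -> u = v.
Proof.
move=> eq_dot; apply/eqP; rewrite -subr_eq0 -(dnorm_eq0 dot).
by rewrite linearBl /= eq_dot subrr.
Qed.

(** The Gram matrix of any basis factors as [M *m M^t*], and [M] is invertible because the form is
    definite; the rows of [invmx M] are the coordinates of an orthonormal family. *)
Lemma orthonormal_basis_exists : exists (n : nat) (e : 'I_n -> H),
  (forall i j, dot (e i) (e j) = (i == j)%:R) /\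
  (forall v, v = \sum_i dot v (e i) *: e i).
Proof.
pose n := \dim {:H}; pose b (i : 'I_n) := (vbasis {:H})`_i.
have bE v : v = \sum_i coord (vbasis {:H}) i v *: b i.
  exact/coord_vbasis/memvf.
have b_free (c : 'I_n -> C) : \sum_i c i *: b i = 0 -> forall i, c i = 0.
  exact/freeP/(basis_free (vbasisP _)).
pose G : 'M_n := \matrix_(i, j) dot (b i) (b j).
have dot_coord (c d : 'rV_n) :
    dot (\sum_i c 0 i *: b i) (\sum_i d 0 i *: b i) = (c *m G *m d^t*) 0 0.
  rewrite dot_sumrZ mxE; apply: eq_bigr => j _; rewrite dot_sumlZ !mxE mulrC.
  by congr (_ * _); apply: eq_bigr => i _; rewrite mxE.
have [u|M GE] := @psdmx_factor _ _ G; first by rewrite -dot_coord dnorm_ge0.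
have M_unit : M \in unitmx.
  rewrite -row_free_unit -kermx_eq0; apply/rowV0P => c /sub_kermxP cM0.
  apply/rowP => i; rewrite mxE; apply: b_free.
  by apply/eqP; rewrite -(dnorm_eq0 dot) dot_coord GE mulmxA cM0 !mul0mx mxE.
pose e i := \sum_j (row i (invmx M)) 0 j *: b j.
exists n, e; have e_orth i j : dot (e i) (e j) = (i == j)%:R.
  have VM k : row k (invmx M) *m M = delta_mx 0 k by rewrite -row_mul mulVmx ?row1.
  rewrite dot_coord GE !mulmxA -mulmxA -map_mxM -trmx_mul !VM.
  by rewrite trmx_delta map_delta_mx -colE !mxE eqxx eq_sym.
(* The remainder [w] is orthogonal to every [e i], hence to the basis [b], hence zero. *)
split=> // v; apply/eqP; rewrite -subr_eq0; set w := v - _.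
have w_e i : dot w (e i) = 0.
  rewrite /w linearBl /= dot_sumlZ (bigD1 i) //= e_orth eqxx mulr1.
  rewrite big1 ?addr0 ?subrr // => j /negPf nij.
  by rewrite e_orth nij mulr0.
have b_e i : b i = \sum_j M i j *: e j.
  transitivity (\sum_k (\sum_j M i j * invmx M j k) *: b k).
    have MV k : \sum_j M i j * invmx M j k = (i == k)%:R.
      by have /matrixP/(_ i k) := mulmxV M_unit; rewrite !mxE.
    rewrite (bigD1 i) //= MV eqxx scale1r big1 ?addr0 // => k /negPf nik.
    by rewrite MV eq_sym nik scale0r.
  under [RHS]eq_bigr => j _ do rewrite scaler_sumr.
  rewrite exchange_big; apply: eq_bigr => k _; rewrite scaler_suml.
  by apply: eq_bigr => j _; rewrite mxE scalerA.
apply/eqP/dot_inj => x; rewrite linear0l (bE x) dot_sumrZ big1 // => i _.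
by rewrite b_e dot_sumrZ big1 ?mulr0 // => j _; rewrite w_e mulr0.
Qed.

End OrthonormalBasis.

(** * Rank-one operators, adjoints and Choi-Kraus decompositions *)

Section CompletelyPositive.
Set Implicit Arguments.
Unset Strict Implicit.
Variables (R : realType) (H : vectType R[i]) (dot : {dot H for conjC}).
Implicit Types (A B L X : 'End(H)) (u v x y : H) (theta : 'End(H) -> 'End(H)).

Definition ketbra x y : 'End(H) := linfun (fun u => dot u y *: x).

Fact ketbra_linear x y : linear (fun u => dot u y *: x).
Proof.
by move=> c u v; rewrite linearDl /= linearZl_LR /= scalerDl scalerA.
Qed.

Lemma ketbraE x y u : ketbra x y u = dot u y *: x.
Proof.
pose lin := GRing.isLinear.Build _ _ _ _ _ (ketbra_linear x y).
pose f : {linear H -> H} := HB.pack (fun u => dot u y *: x) lin.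
exact: (lfunE f u).
Qed.

Lemma adjointE A u v : dot (A u) v = dot u (adjoint dot A v).
Proof.
suff adjA : is_adjoint dot A (adjoint dot A) by apply: adjA.
have [n [e [e_orth eE]]] := orthonormal_basis_exists dot.
apply: (@xgetPex _ 0 [set B | is_adjoint dot A B]%classic).
(* The adjoint sends y to the sum of the [dot y (A (e j)) *: e j]. *)
exists (\sum_j ketbra (e j) (A (e j))) => x y /=.
rewrite sum_lfunE linear_sumr {1}(eE x) linear_sum linear_sumlz.
apply: eq_bigr => j _.
by rewrite linearZ /= linearZl_LR /= ketbraE linearZr_LR /= -dotC mulrC.
Qed.

Lemma adjoint_unique A B : is_adjoint dot A B -> adjoint dot A = B.
Proof.
move=> AB; apply/lfunP => v; apply: (dot_inj (dot := dot)) => u.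
by rewrite dotC -adjointE AB -dotC.
Qed.

Lemma adjointK A : adjoint dot (adjoint dot A) = A.
Proof. by apply: adjoint_unique => u v; rewrite dotC -adjointE -dotC. Qed.

Lemma adjoint_comp A B :
  adjoint dot (A \o B)%VF = (adjoint dot B \o adjoint dot A)%VF.
Proof. by apply: adjoint_unique => u v; rewrite !comp_lfunE !adjointE. Qed.

Lemma adjoint1 : adjoint dot \1%VF = \1%VF.
Proof. by apply: adjoint_unique => u v; rewrite !id_lfunE. Qed.

Lemma adjoint0 : adjoint dot 0 = 0.
Proof. by apply: adjoint_unique => u v; rewrite !zero_lfunE linear0l linear0r. Qed.

(* The Choi matrix c is a Gram matrix; its k-th Gram coordinate s |-> B s k   *)
(* lists the matrix entries of the Kraus operator L k.                        *)
Lemma choi_kraus_exists (theta : {linear 'End(H) -> 'End(H)}) :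
  completely_positive dot theta -> exists Ls, choi_kraus dot theta Ls.
Proof.
move=> theta_cp; have [n [e [e_orth eE]]] := orthonormal_basis_exists dot.
pose E i j := ketbra (e i) (e j).
have E_pos : block_positive dot E.
  move=> u; have -> : \sum_i \sum_j dot (E i j (u j)) (u i)
      = `|\sum_i dot (u i) (e i)| ^+ 2.
    rewrite normCK rmorph_sum mulrC mulr_suml; apply: eq_bigr => i _.
    rewrite mulr_sumr; apply: eq_bigr => j _.
    by rewrite ketbraE linearZl_LR /= mulrC -dotC.
  exact/exprn_ge0/normr_ge0.
have eq_entries A B :
    (forall a b, dot (A (e b)) (e a) = dot (B (e b)) (e a)) -> A = B.
  move=> AB; apply/lfunP => v; rewrite (eE v) !linear_sum.
  apply: eq_bigr => b _; rewrite !linearZ /=; congr (_ *: _).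
  by rewrite (eE (A _)) [RHS]eE; apply: eq_bigr => a _; rewrite AB.
pose c (s t : 'I_n * 'I_n) := dot (theta (E s.1 t.1) (e t.2)) (e s.2).
(* Transposed because [dot] is linear in its first argument. Complete positivity is tested on the
   vectors with coordinates [a (i, b)]. *)
have [|B cE] := @psd_factor _ _ (fun s t => c t s).
  move=> a; have := theta_cp n E E_pos (fun i => \sum_b a (i, b) *: e b).
  congr (0 <= _); rewrite exchange_big.
  transitivity (\sum_j \sum_i \sum_b \sum_k
      a (j, b) * c (i, k) (j, b) * (a (i, k))^*).
    apply: eq_bigr => j _; apply: eq_bigr => i _.
    rewrite [X in dot X]linear_sum linear_sumlz; apply: eq_bigr => b _.
    rewrite linearZ linearZl_LR /= dot_sumrZ mulr_sumr; apply: eq_bigr => k _.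
    by rewrite mulrCA mulrC.
  under eq_bigr => j _ do rewrite exchange_big.
  rewrite pair_bigA; apply: eq_bigr => -[j b] _.
  by rewrite pair_bigA; apply: eq_bigr => -[i k] _.
pose L k : 'End(H) := \sum_s B s k *: ketbra (e s.1) (e s.2).
have L_e k i j : dot (L k (e j)) (e i) = B (i, j) k.
  rewrite sum_lfunE linear_sumlz (bigD1 (i, j)) //= big1 ?addr0 => [|[i' j']].
    by rewrite scale_lfunE ketbraE !linearZl_LR /= !e_orth !eqxx !mulr1.
  rewrite scale_lfunE ketbraE !linearZl_LR /= !e_orth xpair_eqE negb_and.
  by move=> /orP[]/negPf ne; rewrite ?ne 1?eq_sym ?ne ?(mulr0, mul0r).
exists [seq L k | k <- enum 'I_#|{: 'I_n * 'I_n}|] => X.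
rewrite big_map big_enum /=.
have theta_E i j : theta (E i j) = \sum_k (adjoint dot (L k) \o E i j \o L k)%VF.
  apply: eq_entries => a b; rewrite [LHS](cE (j, b) (i, a)).
  rewrite sum_lfunE linear_sumlz; apply: eq_bigr => k _.
  rewrite !comp_lfunE /= adjointE adjointK ketbraE linearZl_LR /= L_e.
  by rewrite (dotC dot (e i)) L_e.
(* Both sides are linear in [X], so the identity on the matrix units [E i j] suffices. *)
have X_E : X = \sum_i \sum_j dot (X (e j)) (e i) *: E i j.
  apply/lfunP => v; rewrite {1}(eE v) linear_sum sum_lfunE.
  under [RHS]eq_bigr => i _ do rewrite sum_lfunE.
  rewrite exchange_big; apply: eq_bigr => j _.
  rewrite linearZ /= {1}(eE (X (e j))) scaler_sumr; apply: eq_bigr => i _.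
  by rewrite scale_lfunE ketbraE !scalerA mulrC.
have sandwich K : (adjoint dot K \o X \o K)%VF = \sum_i \sum_j
    dot (X (e j)) (e i) *: (adjoint dot K \o E i j \o K)%VF.
  apply/lfunP => v; rewrite !comp_lfunE {1}X_E !sum_lfunE linear_sum.
  apply: eq_bigr => i _; rewrite !sum_lfunE linear_sum.
  by apply: eq_bigr => j _; rewrite !scale_lfunE linearZ /= !comp_lfunE.
rewrite {1}X_E linear_sum; under [RHS]eq_bigr => k _ do rewrite sandwich.
rewrite [RHS]exchange_big; apply: eq_bigr => i _; rewrite linear_sum exchange_big.
by apply: eq_bigr => j _; rewrite linearZ /= theta_E scaler_sumr.
Qed.

(** * Words in the Kraus operators and the iterates they decompose *)

Fixpoint words (Ls : seq 'End(H)) n : seq 'End(H) :=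
  if n is n'.+1 then [seq (L \o w)%VF | L <- Ls, w <- words Ls n'] else [:: \1%VF].

Lemma words_comp Ls m n (v w : 'End(H)) : v \in words Ls m -> w \in words Ls n ->
  (v \o w)%VF \in words Ls (m + n)%N.
Proof.
elim: m v => [|m IHm] v /=; first by rewrite inE => /eqP-> ?; rewrite comp_lfun1l.
case/allpairsP => -[L v'] /= [L_in v'_in ->] w_in.
by rewrite -comp_lfunA; apply: allpairs_f => //; apply: IHm.
Qed.

Lemma words_adjoint Ls n w : w \in words (map (adjoint dot) Ls) n ->
  adjoint dot w \in words Ls n.
Proof.
elim: n w => [|n IHn] w; first by rewrite !inE => /eqP->; rewrite adjoint1.
case/allpairsP => -[L' v] /= [/mapP[L L_in ->] /IHn v_in ->].
rewrite adjoint_comp adjointK -/(words Ls n.+1) -addn1; apply: words_comp => //.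
by rewrite -[L]comp_lfun1r; apply: allpairs_f; rewrite ?inE.
Qed.

Lemma choi_kraus_iter theta Ls n : choi_kraus dot theta Ls ->
  choi_kraus dot (iter n theta) (words Ls n).
Proof.
move=> thetaE; elim: n => [|n IHn] X.
  by rewrite big_seq1 adjoint1 comp_lfun1l comp_lfun1r.
rewrite iterSr IHn big_allpairs_dep exchange_big; apply: eq_bigr => w _.
apply/lfunP => u; rewrite thetaE !comp_lfunE sum_lfunE linear_sum sum_lfunE.
by apply: eq_bigr => L _; rewrite adjoint_comp !comp_lfunE.
Qed.

(** Pairing [theta \1%VF u] with [u] gives the sum of the squared norms of the [L u]. *)
Lemma ker_choi_krausP theta Ls u : choi_kraus dot theta Ls ->
  reflect (forall L, L \in Ls -> L u = 0) (u \in lker (theta \1%VF)).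
Proof.
move=> thetaE; rewrite memv_ker thetaE.
apply: (iffP eqP) => [theta_u L L_in|L_u]; last first.
  rewrite sum_lfunE big_seq big1 // => L /L_u Lu.
  by rewrite !comp_lfunE Lu !linear0.
have /eqP : \sum_(L <- Ls) dot (L u) (L u) = 0.
  rewrite -[RHS](linear0l dot u) -[in RHS]theta_u sum_lfunE linear_sumlz.
  by apply: eq_bigr => K _; rewrite !comp_lfunE id_lfunE /= [RHS]adjointE adjointK.
rewrite psumr_eq0 => [|K _]; last exact: dnorm_ge0.
by move/allP/(_ L L_in); rewrite dnorm_eq0 => /eqP.
Qed.

Lemma nilpotent_choi_kraus theta Ls n : choi_kraus dot theta Ls ->
  (forall X, iter n theta X = 0) <-> (forall w, w \in words Ls n -> w = 0).
Proof.
move=> /(@choi_kraus_iter _ _ n) thetaE; split=> [theta0 w w_in|w0 X].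
  apply/lfunP => u; rewrite zero_lfunE.
  apply: (ker_choi_krausP u thetaE _ _ w_in).
  by rewrite memv_ker theta0 zero_lfunE.
by rewrite thetaE big_seq big1 // => w /w0->; rewrite comp_lfun0r.
Qed.

Lemma words_adjoint_eq0 Ls n : (forall w, w \in words Ls n -> w = 0) ->
  forall w, w \in words (map (adjoint dot) Ls) n -> w = 0.
Proof. by move=> w0 w /words_adjoint/w0 w'0; rewrite -[w]adjointK w'0 adjoint0. Qed.

(** The list chosen inside [conjugate_map] serves both maps, so one list and its adjoints carry the
    rest of the argument. *)
Lemma conjugate_mapE (theta : {linear 'End(H) -> 'End(H)}) :
  completely_positive dot theta -> exists Ls, choi_kraus dot theta Ls /\
    choi_kraus dot (conjugate_map dot theta) (map (adjoint dot) Ls).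
Proof.
move=> /choi_kraus_exists[Ls0 Ls0P].
have Ls_P := @xgetPex _ [::] [set Ls | choi_kraus dot theta Ls]%classic
  (ex_intro _ _ Ls0P).
eexists; split=> [|X]; first exact: Ls_P.
by rewrite big_map; apply: eq_bigr => L _; rewrite adjointK.
Qed.

(** * Dimensions of the nil spaces *)

Lemma dim_cap_orthov (U V : {vspace H}) : (U <= V)%VS ->
  (\dim (V :&: orthov dot U) + \dim U = \dim V)%N.
Proof.
move=> sUV; rewrite addnC -dimv_disjoint_sum.
  congr (\dim _); apply/eqP; rewrite eqEsubv subv_add sUV capvSl /=.
  apply/subvP => v v_in.
  have [x x_in [y [vE _ oy]]] := orthogonal_split dot (vbasis U) v.
  rewrite (span_basis (vbasisP U)) in x_in.
  rewrite vE memv_add // memv_cap; apply/andP; split.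
    have -> : y = v - x by rewrite vE addrC addKr.
    by rewrite rpredB // (subvP sUV).
  move: oy; rewrite orthogonalE (span_basis (vbasisP U)) => /subvP; apply.
  by rewrite memv_span ?inE.
apply/eqP; rewrite -subv0; apply/subvP => x; rewrite !memv_cap => /and3P[xU _].
move=> /mem_orthovP/(_ x xU)/eqP; rewrite dnorm_eq0 => /eqP->; exact: mem0v.
Qed.

Lemma lker_id : lker (\1%VF : 'End(H)) = 0%VS.
Proof. by apply/eqP/lker0P => u v; rewrite !id_lfunE. Qed.

Lemma ker_iter_mono theta Ls n : choi_kraus dot theta Ls ->
  (lker (iter n theta \1%VF) <= lker (iter n.+1 theta \1%VF))%VS.
Proof.
move=> thetaE; apply/subvP => u.
move=> /(ker_choi_krausP u (choi_kraus_iter n thetaE)) u0.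
apply/(ker_choi_krausP u (choi_kraus_iter n.+1 thetaE)).
move=> _ /allpairsP[[L w] /= [_ w_in ->]].
by rewrite comp_lfunE u0 // linear0.
Qed.

Lemma sum_dim_nil_space theta Ls n : choi_kraus dot theta Ls ->
  (\sum_(k < n) \dim (nil_space dot theta k) = \dim (lker (iter n theta \1%VF)))%N.
Proof.
move=> thetaE; elim: n => [|n IHn].
  by rewrite big_ord0 /= lker_id dimv0.
rewrite big_ord_recr /= IHn addnC.
rewrite -(dim_cap_orthov (ker_iter_mono n thetaE)); congr (_ + _)%N.
(* The first nil space fits the general formula, as the kernel of the identity is 0. *)
by case: n {IHn} => [|n] //=; rewrite lker_id orthov0 capvf.
Qed.

End CompletelyPositive.

(* Tuples are indexed from 0: entry k of the type is a_(k+1). *)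
Theorem theorem2p7 (R : realType) (H : vectType R[i]) (dot : {dot H for conjC})
    (alpha : {linear 'End(H) -> 'End(H)}) (p : nat)
    (alpha_neq0 : exists X, alpha X != 0)
    (alpha_cp : completely_positive dot alpha)
    (alpha_nil : nilpotent_of_order alpha p) :
  let a := cp_nilpotent_type dot alpha p in
  let a' := cp_nilpotent_type dot (conjugate_map dot alpha) p in
  [/\ nilpotent_of_order (conjugate_map dot alpha) p,
      (forall i : nat, (1 <= i <= p)%N ->
         (\sum_(k < p | (p - i <= k)%N) tnth a k
            <= \sum_(k < p | (k < i)%N) tnth a' k)%N)
    & (\sum_(k < p) tnth a k = \sum_(k < p) tnth a' k)%N].
Proof.
have [Ls [alphaE alphaE']] := conjugate_mapE alpha_cp.
move: (conjugate_map dot alpha) alphaE' => alpha'; set Ls' := map _ Ls => alphaE'.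
have words_p : forall w, w \in words Ls p -> w = 0.
  (* Vanishing of an iterate is equivalent to vanishing of its words. *)
  by apply/(nilpotent_choi_kraus p alphaE); case: alpha_nil.
have words'_p := words_adjoint_eq0 (dot := dot) words_p.
have Ls'' : map (adjoint dot) Ls' = Ls by rewrite mapK //; apply: adjointK.
have sumE (theta : 'End(H) -> 'End(H)) i : (i <= p)%N ->
    (\sum_(k < p | (k < i)%N) tnth (cp_nilpotent_type dot theta p) k
     = \sum_(k < i) \dim (nil_space dot theta k))%N.
  move=> le_ip.
  rewrite (big_ord_widen p (fun k => \dim (nil_space dot theta k))) //.
  by apply: eq_bigr => k _; rewrite tnth_mktuple.
have total theta Ks : choi_kraus dot theta Ks ->
    (forall w, w \in words Ks p -> w = 0) ->
    (\sum_(k < p) tnth (cp_nilpotent_type dot theta p) k = \dim {:H})%N.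
  move=> thetaE /(nilpotent_choi_kraus p thetaE) theta0.
  transitivity (\sum_(k < p) \dim (nil_space dot theta k))%N.
    by apply: eq_bigr => k _; rewrite tnth_mktuple.
  rewrite (sum_dim_nil_space p thetaE) theta0; congr (\dim _).
  by apply/vspaceP => u; rewrite memvf memv_ker zero_lfunE eqxx.
rewrite /=; split=> [|i /andP[_ le_ip]|].
- split=> [|q /(nilpotent_choi_kraus q alphaE') /(words_adjoint_eq0 (dot := dot))].
    exact/(nilpotent_choi_kraus p alphaE').
  rewrite Ls'' => words_q; case: alpha_nil => _; apply.
  exact/(nilpotent_choi_kraus q alphaE).
- rewrite [leqRHS](sumE alpha' i le_ip) (sum_dim_nil_space i alphaE').
  have totalE := total _ _ alphaE words_p.
  (* The head of the type is the dimension of the kernel of [iter (p - i) alpha \1%VF], so the tail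
     is that of its orthogonal complement. *)
  rewrite (bigID (fun k : 'I_p => (k < p - i)%N)) /= in totalE.
  rewrite (sumE alpha _ (leq_subr i p)) (sum_dim_nil_space _ alphaE) in totalE.
  under eq_bigl => k do rewrite leqNgt.
  rewrite -(leq_add2l (\dim (lker (iter (p - i) alpha \1%VF)))) totalE.
  rewrite -(dim_cap_orthov dot (subvf (lker (iter (p - i) alpha \1%VF)))).
  rewrite capfv addnC leq_add2l; apply/dimvS/subvP => u u_orth.
  apply/(ker_choi_krausP u (choi_kraus_iter i alphaE')) => w w_in.
  apply: (dot_inj (dot := dot)) => x; rewrite linear0l adjointE.
  move/mem_orthovP: u_orth; apply.
  apply/(ker_choi_krausP _ (choi_kraus_iter (p - i) alphaE)) => v v_in.
  (* [adjoint dot w] is a word of length i in [Ls], so this product is a word of length p. *)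
  have vw0 : (v \o adjoint dot w)%VF = 0.
    by apply: words_p; rewrite -(subnK le_ip); apply/words_comp/words_adjoint.
  by have /lfunP/(_ x) := vw0; rewrite comp_lfunE zero_lfunE.
- exact: etrans (total _ _ alphaE words_p) (esym (total _ _ alphaE' words'_p)).
Qed.
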